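(* Let $\{X_n\}$ be a Galton--Watson process, $X_0=1$, $X_{n+1}=\sum_{j=1}^{X_n}\xi_j^{(n+1)}$, where $\{\xi_j^{(n)}\}_{n,j\ge1}$ is a family of independent identically distributed non-negative integer-valued random variables with finite mean; let $\xi$ denote a random variable with their common distribution. If the common distribution of the $\xi_j^{(n)}$ is intermediate regularly varying, then, as $x\to\infty$, $$ {\bf P}\{X_2>x\}\sim{\bf E}\xi\,{\bf P}\{\xi>x\}+{\bf P}\{\xi>x/{\bf E}\xi\}. $$
   Context: A distribution $G$ with tail $\overline G(x)=G((x,\infty))>0$ for all $x$ is intermediate regularly varying (at infinity) if $\lim_{\varepsilon\downarrow0}\limsup_{x\to\infty}\overline G((1-\varepsilon)x)/\overline G(x)=1$. The notation $f(x)\sim g(x)$ means $f(x)/g(x)\to1$. An empty sum equals $0$. *)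

(* Defs.v *)
From HB Require Import structures.
From mathcomp Require Import all_boot all_order all_algebra.
From mathcomp Require Import all_classical all_reals all_analysis.

Set Implicit Arguments.
Unset Strict Implicit.
Unset Printing Implicit Defensive.

Import Order.TTheory GRing.Theory Num.Theory.
Import numFieldNormedType.Exports.

Local Open Scope classical_set_scope.
Local Open Scope ring_scope.

(* [f] ~ [g] at +oo, taken literally as a limit of quotients. *)
Definition tail_equivalent (R : realType) (f g : R -> R) : Prop :=
  f x / g x @[x --> +oo] --> (1 : R).

Definition tail (R : realType) (G : probability R R) (x : R) : R :=
  fine (G `]x, +oo[%classic).

(* The limsup is taken in the extended reals, where it always exists; it may
   be +oo for some values of [e]. *)
Definition intermediate_regularly_varying (R : realType)
    (G : probability R R) : Prop :=
  (forall x : R, 0 < tail G x) /\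
  limf_esup (fun x : R => (tail G ((1 - e) * x) / tail G x)%:E)
    (pinfty_nbhs R) @[e --> (0 : R)^'+] --> (1 : \bar R)%E.

Section random_variables.
Context d (Omega : measurableType d) (R : realType) (P : probability Omega R).

(* A nat-valued random variable viewed as a real-valued one, so that its
   expectation and its law on the real line are available. *)
Definition natrRV (X : {RV P >-> nat}) (w : Omega) : R := (X w)%:R.

Let measurable_natrRV (X : {RV P >-> nat}) :
  measurable_fun [set: Omega] (natrRV X).
Proof. by apply: (measurableT_comp (f := fun n : nat => n%:R : R)). Qed.

HB.instance Definition _ (X : {RV P >-> nat}) :=
  isMeasurableFun.Build _ _ _ _ (natrRV X) (measurable_natrRV X).

Definition mutually_independent d' (T : measurableType d') (I : choiceType)
    (D : set I) (X : I -> {RV P >-> T}) : Prop :=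
  forall (J : seq I) (A : I -> set T),
    uniq J -> [set` J] `<=` D -> (forall i, measurable (A i)) ->
    fine (P (\bigcap_(i in [set` J]) (X i @^-1` A i))) =
      \prod_(i <- J) fine (P (X i @^-1` A i)).

Definition same_distribution d' (T : measurableType d')
    (X Y : {RV P >-> T}) : Prop :=
  forall A : set T, measurable A -> distribution P X A = distribution P Y A.

End random_variables.

(* [xi n j] is the number of children of the [j]-th individual of generation
   [n - 1]; only the indices [n, j >= 1] are used. *)
Fixpoint galton_watson (Omega : Type) (xi : nat -> nat -> Omega -> nat)
    (n : nat) (w : Omega) : nat :=
  if n is m.+1 then
    (\sum_(1 <= j < (galton_watson xi m w).+1) xi m.+1 j w)%N
  else 1%N.

(* Main.v *)
Require Import Defs.
From HB Require Import structures.
From mathcomp Require Import all_boot all_order all_algebra.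
From mathcomp Require Import all_classical all_reals all_analysis.
From mathcomp Require Import lra ring.

Set Implicit Arguments.
Unset Strict Implicit.
Unset Printing Implicit Defensive.

Import Order.TTheory GRing.Theory Num.Theory.
Import numFieldNormedType.Exports.

Local Open Scope classical_set_scope.
Local Open Scope ring_scope.

(** Given the number [N] of individuals in the first generation, [X_2] is a sum
    [S_N] of [N] copies of [xi], all independent, and [N] is itself distributed
    like [xi]. Hence [P (X_2 > x)] is the sum over [n] of
    [P (xi = n) * P (S_n > x)]. Write [T] for the tail of [xi] and [m] for its
    mean. The sum [S_N] exceeds [x] either because one of a moderate number of
    summands is large or because there are more than about [x / m] summands:

    - for fixed [n] a single summand is responsible, so that
      [P (S_n > x) ~ n * T x] (lemmas [sum_tail_fixed_le], [sum_tail_fixed_ge]);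
      averaged over [n] this gives [m * T x], provided that limit and average
      may be interchanged;
    - for [n >= (1 + e) * x / m] the law of large numbers makes [P (S_n > x)]
      close to [1] (lemma [sum_tail_lln]), which contributes
      [T ((1 + e) * x / m)];
    - the window [(1 - e) * x / m < n < (1 + e) * x / m] contributes at most
      its probability, and this is where intermediate regular variation is
      indispensable: it makes [T ((1 - e) * x / m)] and [T ((1 + e) * x / m)]
      both comparable to [T (x / m)] with ratio close to [1].

    The interchange is the difficult point. It rests on the domination
    [P (S_n > x) <= C * n * T x], uniformly in [n <= (1 - e) * x / m], a special
    case of [sum_tail_uniform_bound]. That lemma is proved with a Lyapunov
    function. Fix [a > m] and let [H y] be the mean of the positive part of
    [xi - y]. The walk with steps [xi - a] has negative drift; since the slope
    of [H] at [y] is [- T y], the mean of [H (y + a - xi)] is smaller than [H y]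
    by about [(a - m) * T y]. A multiple of this decrease outweighs the
    probability, at most a multiple of [T y], of a jump comparable to [y]. An
    induction on [n] then bounds [P (S_n > y + a * n)] by
    [C * (H y - H (y + kappa * n))], with [kappa = (a - m) / 2], and this is at
    most [C * kappa * n * T y].

    All of this concerns the law of [xi] only. Expectations of functions of
    [xi] are series over [nat] (definition [mean]), and [P (S_n > x)] is defined
    by conditioning on one summand at a time (definition [sum_tail]); lemma
    [independent_sum_tail] recovers it from independence. *)

(** * Expectations over a law on the natural numbers *)

Section mean.
Context {R : realType}.
Implicit Types (p g h : nat -> R) (x y : R).

Definition mean p g : R := limn (series (fun k => p k * g k)).

(** A class of integrands that is stable under the operations used below and
    on which a law with finite mean has absolutely convergent expectations. *)
Definition lin_growth g := exists A : R, forall k, `|g k| <= A * k.+1%:R.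

Record finite_mean_pmf p : Prop := FiniteMeanPmf {
  pmf_ge0 : forall k, 0 <= p k ;
  pmf_sum : series p @ \oo --> (1 : R) ;
  pmf_mean : cvgn (series (fun k => p k * k%:R)) }.

Lemma lin_cst (c : R) : lin_growth (fun=> c).
Proof.
exists `|c| => k; rewrite ler_peMr //.
by rewrite ler1n.
Qed.

Lemma lin_nat : lin_growth (fun k => k%:R).
Proof. by exists 1 => k; rewrite mul1r ger0_norm // ler_nat. Qed.

Lemma linD g h : lin_growth g -> lin_growth h ->
  lin_growth (fun k => g k + h k).
Proof.
move=> [A gA] [B hB]; exists (A + B) => k.
by rewrite mulrDl (le_trans (ler_normD _ _)) // lerD.
Qed.

Lemma linZ c g : lin_growth g -> lin_growth (fun k => c * g k).
Proof.
by move=> [A gA]; exists (`|c| * A) => k; rewrite normrM -mulrA ler_wpM2l.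
Qed.

Lemma linN g : lin_growth g -> lin_growth (fun k => - g k).
Proof. by move=> [A gA]; exists A => k; rewrite normrN. Qed.

Lemma lin_le g h : (forall k, `|g k| <= `|h k|) -> lin_growth h -> lin_growth g.
Proof. by move=> gh [A hA]; exists A => k; exact: le_trans (gh k) (hA k). Qed.

Lemma lin_bool (b : nat -> bool) : lin_growth (fun k => (b k)%:R).
Proof. by apply: (lin_le (h := fun=> 1)) (lin_cst 1) => k; case: (b k);
  rewrite ?normr1 ?normr0. Qed.

Lemma lin_boolM (b : nat -> bool) g : lin_growth g ->
  lin_growth (fun k => g k * (b k)%:R).
Proof.
apply: lin_le => k.
by case: (b k); rewrite ?mulr1 // mulr0 normr0 normr_ge0.
Qed.

Lemma lin_01 g : (forall k, 0 <= g k <= 1) -> lin_growth g.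
Proof.
move=> g01; apply: (lin_le (h := fun=> 1)) (lin_cst 1) => k.
by have /andP[? ?] := g01 k; rewrite normr1 ger0_norm.
Qed.

End mean.

Ltac lin := repeat first
  [ assumption | apply: lin_cst | apply: lin_nat | apply: lin_bool
  | apply: lin_boolM | apply: linN | apply: linD | apply: linZ ].

Section mean_theory.
Context {R : realType} (p : nat -> R) (pP : finite_mean_pmf p).
Implicit Types (g h : nat -> R) (x y : R).

Local Notation E := (mean p).

Lemma mean_cvg g : lin_growth g -> cvgn (series (fun k => p k * g k)).
Proof.
move=> [A gA]; apply: normed_cvg.
have c1 : cvgn (series (fun k => p k * k.+1%:R)).
  have -> : (fun k => p k * k.+1%:R) = (fun k => p k * k%:R) + p.
    by apply/funext => k; rewrite [RHS]/= -natr1 mulrDr mulr1.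
  apply: is_cvg_seriesD; first exact: pmf_mean pP.
  by apply/cvg_ex; exists 1; exact: pmf_sum.
apply: (@series_le_cvg _ _ (fun k => A * (p k * k.+1%:R))).
- by move=> k; exact: normr_ge0.
- move=> k; rewrite mulrCA mulr_ge0 ?(pmf_ge0 pP) //.
  exact: le_trans (normr_ge0 _) (gA k).
- move=> k /=; rewrite normrM (ger0_norm (pmf_ge0 pP k)) mulrCA.
  by rewrite ler_wpM2l ?(pmf_ge0 pP).
- exact: (is_cvg_seriesZ (f := fun k => p k * k.+1%:R) (k := A)) c1.
Qed.

Lemma mean_le g h : lin_growth g -> lin_growth h ->
  (forall k, g k <= h k) -> E g <= E h.
Proof.
move=> lg lh gh; apply: lim_series_le (mean_cvg lg) (mean_cvg lh) _ => k.
by rewrite ler_wpM2l ?(pmf_ge0 pP).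
Qed.

Lemma meanD g h : lin_growth g -> lin_growth h ->
  E (fun k => g k + h k) = E g + E h.
Proof.
move=> lg lh; rewrite /mean -lim_seriesD; [|exact: mean_cvg..].
by congr (limn (series _)); apply/funext => k; rewrite mulrDr.
Qed.

Lemma meanZ c g : lin_growth g -> E (fun k => c * g k) = c * E g.
Proof.
move=> lg; rewrite /mean -[RHS]/(c *: _) -lim_seriesZ; last exact: mean_cvg.
by congr (limn (series _)); apply/funext => k /=; rewrite mulrCA.
Qed.

Lemma mean_cst c : E (fun=> c) = c.
Proof.
rewrite -[LHS]/(mean p (fun=> c)).
have -> : (fun=> c) = (fun k : nat => c * 1) by rewrite mulr1.
rewrite meanZ ?mulr1; last exact: lin_cst.
rewrite /mean.
have -> : (fun k => p k * 1) = p by apply/funext => k; rewrite mulr1.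
by rewrite (cvg_lim (@Rhausdorff R) (pmf_sum pP)) mulr1.
Qed.

Lemma mean_ge0 g : lin_growth g -> (forall k, 0 <= g k) -> 0 <= E g.
Proof. by move=> lg g0; rewrite -(mean_cst 0); apply: mean_le => //;
  exact: lin_cst. Qed.

Lemma mean01 g : (forall k, 0 <= g k <= 1) -> 0 <= E g <= 1.
Proof.
move=> g01; have lg := lin_01 g01; apply/andP; split.
  by apply: mean_ge0 => // k; case/andP: (g01 k).
by rewrite -(mean_cst 1); apply: mean_le => [//||k];
  [exact: lin_cst|case/andP: (g01 k)].
Qed.

Lemma mean_trunc g (K : nat) :
  E (fun k => g k * (k <= K)%N%:R) = series (fun k => p k * g k) K.+1.
Proof.
apply: lim_near_cst => //; near=> n.
have Kn : (K.+1 <= n)%N by near: n; exact: nbhs_infty_ge.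
have tail0 : \sum_(K.+1 <= i < n) p i * (g i * (i <= K)%:R) = 0.
  by rewrite big_nat big1 // => k /andP[kK _]; rewrite leqNgt kK !mulr0.
rewrite /series /= (big_cat_nat (n := K.+1)) //= tail0 addr0.
by apply: eq_big_nat => k /andP[_ kK]; rewrite -ltnS kK mulr1.
Unshelve. all: by end_near. Qed.

(** Uniform integrability of a law with finite mean: the excess is the
    remainder of the convergent series of the mean. *)
Lemma mean_excess_cvg0 (e : R) : 0 < e ->
  \forall K \near \oo, E (fun k => k%:R * (K < k)%N%:R) <= e.
Proof.
move=> e0; have c := pmf_mean pP.
have /cvgrPdist_le /(_ e e0) [N _ H] : series (fun k => p k * k%:R) @ \oo -->
  limn (series (fun k => p k * k%:R)) by [].
exists N => //= K NK.
have /= := H K.+1 (leqW NK); apply: le_trans; rewrite -mean_trunc.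
apply: le_trans (ler_norm _); rewrite lerBrDr -[leRHS]/(E (fun k => k%:R)).
rewrite -meanD; [|lin..].
apply: mean_le; [lin..|] => k.
by rewrite -mulrDr ltnNge -natrD addn_negb // mulr1.
Qed.

End mean_theory.

(** * Tails of sums and intermediate regular variation *)

Section tails.
Context {R : realType}.
Implicit Types (p : nat -> R) (x y : R).

Definition upper_tail p x : R := mean p (fun k => (x < k%:R)%R%:R).

(** [sum_tail p n x] is the probability that the sum of [n] independent
    variables of law [p] exceeds [x], computed by conditioning on one of them
    at each step. *)
Fixpoint sum_tail p n x : R :=
  if n is n'.+1 then mean p (fun k => sum_tail p n' (x - k%:R))
  else (x < 0)%R%:R.

(** Intermediate regular variation without the limit superior: the ratio is
    at most [1 + eta] eventually, for a single suitable [e]. When [T] is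
    a tail, and hence monotone, the same holds for all smaller positive [e]. *)
Definition intermediate_regular (T : R -> R) := (forall x, 0 < T x) /\
  forall eta : R, 0 < eta -> exists2 e : R, 0 < e < 1 &
    \forall x \near +oo, T ((1 - e) * x) <= (1 + eta) * T x.

Lemma near_pinftyM (c : R) (Q : R -> Prop) : 0 < c ->
  (\forall x \near +oo, Q x) -> \forall x \near +oo, Q (c * x).
Proof.
move=> c0 [M [Mr H]]; exists (M / c); split; first exact: num_real.
by move=> x /= Mx; apply: H; rewrite mulrC -ltr_pdivrMr.
Qed.

Lemma near_pinftyD (c : R) (Q : R -> Prop) :
  (\forall x \near +oo, Q x) -> \forall x \near +oo, Q (c + x).
Proof.
move=> [M [Mr H]]; exists (M - c); split; first exact: num_real.
by move=> x /= Mx; apply: H; rewrite -ltrBlDl.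
Qed.

Variables (p : nat -> R) (pP : finite_mean_pmf p).
Local Notation E := (mean p).
Local Notation T := (upper_tail p).
Local Notation S := (sum_tail p).
Local Notation m := (mean p (fun k => k%:R)).

Lemma tail_le x y : x <= y -> T y <= T x.
Proof.
move=> xy; apply: mean_le => //; [lin..|] => k /=.
by rewrite ler_nat; case: ltP => // yk; rewrite (le_lt_trans xy yk).
Qed.

Lemma tail_ge0 x : 0 <= T x.
Proof. by apply: mean_ge0 => //; lin. Qed.

Lemma tail_cvg0 (e : R) : 0 < e -> \forall x \near +oo, T x <= e.
Proof.
move=> e0; have [K _ /(_ K (leqnn K)) HK] := mean_excess_cvg0 pP e0.
near=> x.
have Kx : K%:R <= x by near: x; apply: nbhs_pinfty_ge; exact: num_real.
apply: le_trans HK; apply: mean_le => //; [lin..|] => k /=.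
case: ltP => [xk|_]; last by rewrite mulr_ge0.
have Kk : (K < k)%N by rewrite -(ltr_nat R) (le_lt_trans Kx).
by rewrite Kk mulr1 ler_nat (leq_ltn_trans _ Kk).
Unshelve. all: by end_near. Qed.

Lemma sum_tail01 n x : 0 <= S n x <= 1.
Proof.
elim: n x => [|n IHn] x /=; last by apply: mean01.
by case: (x < 0); rewrite ?ler01 ?lexx.
Qed.

Lemma sum_tail_ge0 n x : 0 <= S n x.
Proof. by case/andP: (sum_tail01 n x). Qed.

Lemma sum_tail_le1 n x : S n x <= 1.
Proof. by case/andP: (sum_tail01 n x). Qed.

Lemma lin_sum_tail n (f : nat -> R) : lin_growth (fun k => S n (f k)).
Proof. by apply: lin_01 => k; exact: sum_tail01. Qed.

Lemma lin_sum_tail_index x : lin_growth (fun n => S n x).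
Proof. by apply: lin_01 => k; exact: sum_tail01. Qed.

Lemma sum_tail_le n x y : x <= y -> S n y <= S n x.
Proof.
elim: n x y => [|n IHn] x y xy /=.
  by rewrite ler_nat; case: ltP => // y0; rewrite (le_lt_trans xy y0).
apply: mean_le => //; [exact: lin_sum_tail..|] => k /=.
by apply: IHn; rewrite lerD2r.
Qed.

Hypothesis T_irv : intermediate_regular T.

Lemma mean_gt0 : 0 < m.
Proof.
apply: (lt_le_trans (T_irv.1 0)); apply: mean_le => //; [lin..|] => k /=.
by rewrite ltr0n ler_nat; case: k.
Qed.

(** Apply the definition at [(1 + e) * x], since [(1 - e) * (1 + e) <= 1]. *)
Lemma tail_irv_up (eta : R) : 0 < eta -> exists2 e : R, 0 < e < 1 &
  \forall x \near +oo, T x <= (1 + eta) * T ((1 + e) * x).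
Proof.
move=> /T_irv.2[e /andP[e0 e1] H]; exists e; first by rewrite e0.
have e10 : 0 < 1 + e by lra.
near=> x.
have x0 : 0 <= x by near: x; apply: nbhs_pinfty_ge; exact: num_real.
apply: (@le_trans _ _ (T ((1 - e) * ((1 + e) * x)))).
  by apply: tail_le; nra.
by near: x; exact: (near_pinftyM (c := 1 + e) e10 H).
Unshelve. all: by end_near. Qed.

(** Each contraction by [1 - e] costs at most a factor [2], and finitely many
    contractions reach any [c > 0]. *)
Lemma tail_dominated_variation (c : R) : 0 < c -> exists2 D : R, 1 <= D &
  \forall x \near +oo, T (c * x) <= D * T x.
Proof.
move=> c0; have [e /andP[e0 e1] H] := T_irv.2 1 ltr01.
have e10 : 0 < 1 - e by lra.
have step j : \forall x \near +oo, T ((1 - e) ^+ j * x) <= 2 ^+ j * T x.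
  elim: j => [|j IHj]; first by near=> x; rewrite !expr0 !mul1r.
  near=> x; rewrite exprS -mulrA.
  apply: (@le_trans _ _ (2 * T ((1 - e) ^+ j * x))).
    near: x; rewrite -[2]/(1 + 1).
    exact: (near_pinftyM (Q := fun y => T ((1 - e) * y) <=
      (1 + 1) * T y) (exprn_gt0 j e10) H).
  by rewrite exprS -mulrA ler_wpM2l //; near: x.
have [j jc] : exists j, (1 - e) ^+ j <= c.
  have : geometric 1 (1 - e) @ \oo --> (0 : R).
    by apply: cvg_geometric; rewrite ger0_norm; lra.
  move=> /cvgrPdist_le /(_ c c0) [j _ /(_ j (leqnn j))]/=.
  rewrite sub0r normrN mul1r ger0_norm; first by exists j.
  by rewrite exprn_ge0 // ltW.
exists (2 ^+ j); first by rewrite exprn_ege1 // ler1n.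
near=> x.
have x0 : 0 <= x by near: x; apply: nbhs_pinfty_ge; exact: num_real.
apply: (@le_trans _ _ (T ((1 - e) ^+ j * x))); first by apply: tail_le;
  rewrite ler_wpM2r.
by near: x; exact: step.
Unshelve. all: by end_near. Qed.

(** A fixed shift is eventually smaller than a fixed proportion of [x]. *)
Lemma tail_long (u eta : R) : 0 < eta ->
  \forall x \near +oo, T (x - u) <= (1 + eta) * T x.
Proof.
move=> eta0; have [e /andP[e0 e1] H] := T_irv.2 eta eta0.
near=> x; apply: (@le_trans _ _ (T ((1 - e) * x))).
  apply: tail_le; suff : u <= x * e by lra.
  rewrite -ler_pdivrMr //; near: x; apply: nbhs_pinfty_ge; exact: num_real.
by near: x.
Unshelve. all: by end_near. Qed.

End tails.

(** * A uniform large deviation bound *)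

Section large_deviations.
Context {R : realType}.
Variables (p : nat -> R) (pP : finite_mean_pmf p).
Local Notation E := (mean p).
Local Notation T := (upper_tail p).
Local Notation S := (sum_tail p).
Local Notation m := (mean p (fun k => k%:R)).
Implicit Types (x y : R).

(** The integrated tail of the law, and the Lyapunov function of the walk. *)
Definition stop_loss y : R := E (fun k => Num.max 0 (k%:R - y)).
Local Notation H := stop_loss.

Lemma lin_stop_loss y : lin_growth (fun k => Num.max 0 (k%:R - y) : R).
Proof.
apply: (@lin_le _ _ (fun k => k%:R + `|y|)); last by lin.
move=> k; rewrite ger0_norm ?le_max ?lexx // (ger0_norm (addr_ge0 _ _)) //.
rewrite ge_max addr_ge0 //= lerD2l.
by rewrite -normrN ler_norm.
Qed.

(** Convexity: [- T v] is a subgradient of [stop_loss] at [v]. No order between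
    [v] and [w] is required, so that the bound serves for upward and downward
    steps of the walk alike. *)
Lemma stop_loss_diff v w : H v - H w <= (w - v) * T v.
Proof.
rewrite lerBlDr /upper_tail -meanZ //; last by lin.
rewrite -meanD //; [|lin|exact: lin_stop_loss].
apply: mean_le => //; [exact: lin_stop_loss|lin; exact: lin_stop_loss|].
move=> k /=; rewrite ge_max; apply/andP; split.
  case: ltP => kv; last by rewrite mulr0 add0r le_max lexx.
  rewrite mulr1; have [?|?] := leP 0 (k%:R - w); lra.
case: ltP => kv; last by rewrite mulr0 add0r; have [?|?] := leP 0 (k%:R - w);
  lra.
by rewrite mulr1; have [?|?] := leP 0 (k%:R - w); lra.
Qed.

Lemma stop_loss_le v w : v <= w -> H w <= H v.
Proof.
move=> vw; rewrite -subr_ge0 -oppr_le0 opprB.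
apply: le_trans (stop_loss_diff _ _) _; rewrite mulr_le0_ge0 ?subr_le0 //.
exact: tail_ge0.
Qed.

Hypothesis T_irv : intermediate_regular T.

(** For bounded steps [T] is asymptotically constant along the step. A factor
    [1 + eta / L] with [L] larger than every step in question makes the total
    error at most [eta * T y], whatever the sign of [k - a]. *)
Lemma increment_tail_bound (a : R) (K : nat) (eta : R) : a <= K%:R -> 0 < eta ->
  \forall y \near +oo, forall k, (k <= K)%N ->
    (k%:R - a) * T (y + a - k%:R) <= (k%:R - a) * T y + eta * T y.
Proof.
move=> aK eta0.
pose L : R := K%:R + `|a| + 1.
have L0 : 0 < L by rewrite ltr_wpDl // addr_ge0.
have eL : 0 < eta / L by rewrite divr_gt0.
have n1 := tail_long pP T_irv L eL.
near=> y => k kK.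
have kK' : k%:R <= K%:R :> R by rewrite ler_nat.
have k0 : 0 <= k%:R :> R by [].
have aa : a <= `|a| by rewrite ler_norm.
have aa' : - a <= `|a| by rewrite -normrN ler_norm.
have T0 z : 0 <= T z by exact: tail_ge0.
have D1 : T (y - L) <= (1 + eta / L) * T y by near: y.
have D2 : T y <= (1 + eta / L) * T (L + y).
  rewrite -[X in T X <= _](addKr L) addrC.
  by near: y; exact: (near_pinftyD L (Q := fun x => T (x - L) <=
    (1 + eta / L) * T x)).
have Ly : T (L + y) <= T y by apply: tail_le => //; lra.
have T1 : T (y + a - k%:R) <= T (y - L) by apply: tail_le => //; rewrite /L;
  lra.
have T2 : T (L + y) <= T (y + a - k%:R) by apply: tail_le => //; rewrite /L;
  lra.
have e2 : eta = (eta / L) * L by rewrite divfK // gt_eqF.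
set c := eta / L in eL D1 D2 e2 *.
have cT0 : 0 <= c * T y by rewrite mulr_ge0 // ltW.
have [ka|ka] := leP a k%:R.
  have : (k%:R - a) * T (y + a - k%:R) <= (k%:R - a) * ((1 + c) * T y).
    by rewrite ler_wpM2l ?subr_ge0 // (le_trans T1).
  have : (k%:R - a) * (c * T y) <= L * (c * T y).
    by apply: ler_wpM2r => //; rewrite /L; lra.
  rewrite e2; lra.
have D3 : T y <= T (y + a - k%:R) + c * T y.
  apply: (le_trans D2); rewrite mulrDl mul1r lerD // ler_wpM2l // ltW //.
have : (a - k%:R) * T y <= (a - k%:R) * T (y + a - k%:R) + (a - k%:R) * (c * T
  y).
  by rewrite -mulrDr ler_wpM2l // subr_ge0 ltW.
have : (a - k%:R) * (c * T y) <= L * (c * T y).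
  by apply: ler_wpM2r => //; rewrite /L; lra.
have -> : L * (c * T y) = eta * T y by rewrite e2; ring.
lra.
Unshelve. all: by end_near. Qed.

(** The induction along the walk with drift [m - a]. The right-hand side keeps
    the difference of two values of [stop_loss] because it is at most of order
    [n * T y], whereas [C * stop_loss y] alone, which is of the right order for
    the supremum of the walk, would be too large for small [n]. Half of the
    drift pays for the growth of the second argument by [(a - m) / 2] at each
    step; the other half absorbs the error terms. *)
Lemma sum_tail_stop_loss (a : R) : m < a -> exists2 C : R, 0 < C &
  forall n y, 0 <= y ->
    S n (y + a * n%:R) <= C * (H y - H (y + (a - m) / 2 * n%:R)).
Proof.
move=> ma; have m0 := mean_gt0 pP T_irv.
set kap := (a - m) / 2.
have kap0 : 0 < kap by rewrite /kap; lra.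
have e1 : a = m + 2 * kap by rewrite /kap; field.
clearbody kap.
have T0 z : 0 <= T z by exact: tail_ge0.
have [D D1 nD] := tail_dominated_variation pP T_irv (c := 2^-1) ltac:(lra).
have D0 : 0 < D by exact: lt_le_trans ltr01 D1.
have De : 0 < kap / 4 / D by rewrite !divr_gt0.
(* Steps above [K] contribute, even after [T] has been multiplied by [D],
   only a quarter of [kap]. *)
have [K aK eK] : exists2 K : nat, a <= K%:R &
    E (fun k => k%:R * (K < k)%N%:R) <= kap / 4 / D.
  near \oo => K; exists K; last by near: K; exact: mean_excess_cvg0.
  by near: K; exact: nbhs_infty_ger.
set eps := E _ in eK.
have Deps : D * eps <= kap / 4 by rewrite mulrC -ler_pdivlMr //.
have eta0 : 0 < kap / 4 by lra.
have nI := increment_tail_bound aK eta0.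
have [y0 [y00 Ky0 Dy0 Iy0]] : exists y0, [/\ 0 <= y0, K%:R * 2 <= y0,
    forall y, y0 <= y -> T (2^-1 * y) <= D * T y &
    forall y, y0 <= y -> forall k, (k <= K)%N ->
    (k%:R - a) * T (y + a - k%:R) <= (k%:R - a) * T y + kap / 4 * T y].
  case: nD => M1 [_ H1]; case: nI => M2 [_ H2].
  exists (`|M1| + `|M2| + 1 + K%:R * 2); split.
  - by rewrite !addr_ge0.
  - by rewrite lerDr !addr_ge0.
  - move=> y My; apply: H1; apply: le_lt_trans (ler_norm M1) _.
    have := normr_ge0 M2; have : 0 <= K%:R * 2 :> R by rewrite mulr_ge0.
    lra.
  - move=> y My; apply: H2; apply: le_lt_trans (ler_norm M2) _.
    have := normr_ge0 M1; have : 0 <= K%:R * 2 :> R by rewrite mulr_ge0.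
    lra.
(* The first term of [C] lets the drift dominate the probability of a step
   above [y / 2] when [y >= y0]; the second makes the bound trivial, that is
   at least [1], when [y < y0] and [n > 0]. *)
pose C : R := 2 * D / kap + (kap * T (y0 + kap))^-1.
have Cpos2 : 0 < (kap * T (y0 + kap))^-1
  by rewrite invr_gt0 mulr_gt0 // T_irv.1.
have C1 : 2 * D / kap <= C by rewrite lerDl ltW.
have Dk : 0 < 2 * D / kap by rewrite !mulr_gt0 ?invr_gt0 //.
have C2 : (kap * T (y0 + kap))^-1 <= C by rewrite lerDr ltW.
have C0 : 0 < C by rewrite addr_gt0.
exists C => // n; elim: n => [|n IHn] y yge0.
  by rewrite /= !mulr0 !addr0 subrr mulr0 ltNge yge0.
pose z := y + kap * n%:R.
have zk : y + kap * n.+1%:R = z + kap by rewrite /z -natr1; ring.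
rewrite zk.
have yz : y <= z by rewrite lerDl mulr_ge0 // ltW.
have [yy0|yy0] := leP y0 y; last first.
  apply: le_trans (sum_tail_le1 pP _ _) _.
  have h1 : H (z + kap) <= H (y + kap) by apply: stop_loss_le; rewrite lerD2r.
  have h2 := stop_loss_diff (y + kap) y.
  have h3 : T (y0 + kap) <= T (y + kap) by apply: tail_le => //;
    rewrite lerD2r ltW.
  have h4 : kap * T (y0 + kap) <= H y - H (z + kap).
    have : kap * T (y0 + kap) <= kap * T (y + kap) by rewrite ler_wpM2l // ltW.
    lra.
  apply: (@le_trans _ _ (C * (kap * T (y0 + kap)))); last
    by rewrite ler_wpM2l // ltW.
  rewrite -ler_pdivrMr ?mulr_gt0 ?T_irv.1 // mul1r //.
set tau := T (z + kap).
have tauy : tau <= T y by apply: tail_le => //; lra.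
have tau0 : 0 <= tau by exact: T0.
pose Del := H y - H (z + kap).
have Del0 : 0 <= Del by rewrite subr_ge0; apply: stop_loss_le; lra.
(* The induction hypothesis is used for steps [k <= y / 2] only; for larger
   ones the probability is at most [1], and the remaining terms, whose shape
   is forced by the small steps, are nonnegative since then [k > K >= a]. *)
have pt k : S n (y + a * n.+1%:R - k%:R) <=
   ((2^-1 * y < k%:R)%R%:R + C * (D * T y) * (k%:R * (K < k)%N%:R))
    + (C * (T y - tau) * k%:R
       + C * (Del + (kap / 4 - a) * T y + (a - kap) * tau)).
  have -> : y + a * n.+1%:R - k%:R = (y + a - k%:R) + a * n%:R.
    by rewrite -natr1; ring.
  have k0 : 0 <= k%:R :> R by [].
  have [yk|yk] := ltP (2^-1 * y) k%:R.
    have Kk' : K%:R < k%:R :> R by lra.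
    have Kk : (K < k)%N by rewrite -(ltr_nat R).
    apply: le_trans (sum_tail_le1 pP _ _) _; rewrite Kk mulr1 -[leRHS]addrA.
    rewrite -[leLHS]/(true%:R) lerDl.
    have -> : C * (D * T y) * k%:R + (C * (T y - tau) * k%:R +
        C * (Del + (kap / 4 - a) * T y + (a - kap) * tau)) =
      C * (Del + kap / 4 * T y + (k%:R - a) * (T y - tau) + (D * k%:R * T y -
        kap * tau)).
      by ring.
    apply: mulr_ge0; first exact: ltW.
    have q1 : 0 <= (k%:R - a) * (T y - tau) by apply: mulr_ge0; lra.
    have q2 : 0 <= kap / 4 * T y by rewrite mulr_ge0 // ltW.
    have q3 : kap * tau <= D * k%:R * T y.
      apply: ler_pM => //; first by rewrite ltW.
      apply: (@le_trans _ _ (1 * k%:R)); first by rewrite mul1r; lra.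
      by rewrite ler_wpM2r.
    lra.
  have yak : 0 <= y + a - k%:R by lra.
  apply: (le_trans (IHn _ yak)).
  have hh1 := stop_loss_diff (y + a - k%:R) y.
  have hh2 := stop_loss_diff (z + kap) (y + a - k%:R + kap * n%:R).
  have hh2' : H (z + kap) - H (y + a - k%:R + kap * n%:R) <=
    (a - k%:R - kap) * tau.
    by apply: le_trans hh2 _; rewrite le_eqVlt; apply/orP; left; apply/eqP;
      congr (_ * _); rewrite /z; ring.
  have hh1' : H (y + a - k%:R) - H y <= (k%:R - a) * T (y + a - k%:R).
    by apply: le_trans hh1 _; rewrite le_eqVlt; apply/orP; left; apply/eqP;
      ring.
  have hh3 : (k%:R - a) * T (y + a - k%:R) <=
      (k%:R - a) * T y + kap / 4 * T y + D * T y * (k%:R * (K < k)%N%:R).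
    have [kK|Kk] := leqP k K; first by rewrite !mulr0 addr0; exact: Iy0.
    have Kk' : K%:R < k%:R :> R by rewrite ltr_nat.
    have g1 : T (y + a - k%:R) <= D * T y.
      by apply: le_trans (Dy0 _ yy0); apply: tail_le => //; lra.
    have g2 : (k%:R - a) * T (y + a - k%:R) <= k%:R * (D * T y).
      by apply: ler_pM => //; lra.
    have g3 : 0 <= (k%:R - a) * T y by rewrite mulr_ge0 //; lra.
    have g4 : 0 <= kap / 4 * T y by rewrite mulr_ge0 // ltW.
    by rewrite mulr1; lra.
  rewrite add0r -[C * (D * T y) * _]mulrA -[C * (T y - tau) * _]mulrA -!mulrDr.
  rewrite ler_wpM2l // ?(ltW C0) //.
  move: hh1' hh2' hh3; rewrite /Del; set X := k%:R * (K < k)%N%:R; lra.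
rewrite [S _ _]/=.
have lS := lin_sum_tail pP n (fun k => y + a * n.+1%:R - k%:R).
apply: le_trans (mean_le pP lS _ pt) _; first by lin.
rewrite !meanD //; [|lin..]; rewrite !meanZ //; [|lin..]; rewrite (mean_cst pP).
rewrite -/(upper_tail p _) -/eps.
have Dy := Dy0 _ yy0.
(* The drift gives [- kap * C * T y] in total; [f1] spends half of it on the
   large steps, [f2] and the error in [Iy0] take a quarter each. *)
have f1 : D * T y <= C * (kap / 2) * T y.
  apply: ler_wpM2r => //; apply: (@le_trans _ _ (2 * D / kap * (kap / 2))).
    by rewrite le_eqVlt; apply/orP; left; apply/eqP; field; rewrite gt_eqF.
  by rewrite ler_wpM2r // ltW // divr_gt0.
have f2 : C * T y * (D * eps) <= C * T y * (kap / 4)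
  by rewrite ler_wpM2l // mulr_ge0 // ltW.
have f3 : 0 <= C * (kap * (T y - tau)) by rewrite !mulr_ge0 // ?subr_ge0 // ltW.
rewrite -/Del.
suff : C * T y * (D * eps) + (C * (T y - tau) * m + C * ((kap / 4 - a) * T y +
  (a - kap) * tau)) <= - (C * (kap / 2) * T y).
  lra.
have -> : C * (T y - tau) * m + C * ((kap / 4 - a) * T y + (a - kap) * tau) =
  - (7 / 4 * kap * C * T y) + kap * C * tau.
  by rewrite e1; field.
lra.
Unshelve. all: by end_near. Qed.

(** The large deviation bound, valid for all [n] and [y >= 0] at once. *)
Lemma sum_tail_uniform_bound (a : R) : m < a -> exists2 C : R, 0 < C &
  forall n y, 0 <= y -> S n (y + a * n%:R) <= C * n%:R * T y.
Proof.
move=> ma; have [C C0 HC] := sum_tail_stop_loss ma.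
have kap0 : 0 < (a - m) / 2 by lra.
exists (C * ((a - m) / 2)); first exact: mulr_gt0.
move=> n y y0; apply: le_trans (HC n y y0) _.
rewrite -!mulrA; apply: ler_wpM2l; first exact: ltW.
apply: le_trans (stop_loss_diff _ _) _.
by rewrite le_eqVlt; apply/orP; left; apply/eqP; ring.
Qed.

End large_deviations.

(** * A random number of summands *)

Section random_sum.
Context {R : realType}.
Variables (p : nat -> R) (pP : finite_mean_pmf p).
Local Notation E := (mean p).
Local Notation T := (upper_tail p).
Local Notation S := (sum_tail p).
Local Notation m := (mean p (fun k => k%:R)).
Implicit Types (x y : R).
Hypothesis T_irv : intermediate_regular T.

(** If [xi + S_n > x], then [xi] or [S_n] exceeds [(1 - delta) * x], or else
    both exceed [delta * x]. *)
Lemma sum_tailS_le n (delta x : R) : 0 <= delta * x ->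
  S n.+1 x <= T ((1 - delta) * x) + S n ((1 - delta) * x) +
              S n (delta * x) * T (delta * x).
Proof.
move=> dx0 /=.
rewrite -(mean_cst pP (S n ((1 - delta) * x))) /upper_tail -(meanZ pP); last
  by lin.
rewrite -!meanD //; [|lin..].
apply: mean_le => //; [exact: lin_sum_tail|lin|] => k /=.
have [k1|k1] := ltP ((1 - delta) * x) k%:R.
  apply: le_trans (sum_tail_le1 pP _ _) _.
  by rewrite -addrA lerDl addr_ge0 ?mulr_ge0 ?sum_tail_ge0.
rewrite add0r.
have [k2|k2] := ltP (delta * x) k%:R.
  rewrite mulr1 ler_wpDl ?sum_tail_ge0 //.
  by apply: sum_tail_le => //; lra.
by rewrite mulr0 addr0; apply: sum_tail_le => //; lra.
Qed.

Lemma sum_tail_neg n x : x < 0 -> S n x = 1.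
Proof.
elim: n x => [|n IHn] x x0 /=; first by rewrite x0.
rewrite -[RHS](mean_cst pP 1); congr mean; apply/funext => k.
by apply: IHn; rewrite subr_lt0 (lt_le_trans x0).
Qed.

(** It suffices that [xi > x] or [S_n > x], and these events are independent. *)
Lemma sum_tailS_ge n x : T x + S n x - S n x * T x <= S n.+1 x.
Proof.
rewrite -[X in _ + X - _](mean_cst pP (S n x)) /upper_tail -mulNr -(meanZ pP);
  last by lin.
rewrite -!meanD //; [|lin..].
rewrite -[leRHS]/(E (fun k => S n (x - k%:R))).
apply: mean_le => //; [lin|exact: lin_sum_tail|] => k; cbv beta.
have [xk|xk] := ltP x k%:R; last first.
 by rewrite mulr0 add0r addr0; apply: sum_tail_le => //; rewrite gerBl.
by rewrite (sum_tail_neg n (x := x - k%:R)) ?subr_lt0 // mulr1 addrK.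
Qed.

Lemma near_forall_leq (Q : nat -> R -> Prop) (K : nat) :
  (forall n, \forall x \near +oo, Q n x) ->
  \forall x \near +oo, forall n, (n <= K)%N -> Q n x.
Proof.
move=> nQ; elim: K => [|K IHK]; first by apply: filterS (nQ 0%N) => x Qx [].
apply: filterS2 IHK (nQ K.+1) => x QK QSK n.
by rewrite leq_eqVlt => /predU1P[-> //|]; rewrite ltnS; exact: QK.
Qed.

(** By induction on [n]: in [sum_tailS_le] the joint event has probability of
    order [T (delta * x) ^+ 2], which is negligible because dominated variation
    bounds one factor by a multiple of [T x] and the other tends to [0]. *)
Lemma sum_tail_fixed_le n (eta : R) : 0 < eta ->
  \forall x \near +oo, S n x <= (n%:R + eta) * T x.
Proof.
elim: n eta => [|n IHn] eta eta0.
  near=> x; have x0 : 0 <= x by near: x; apply: nbhs_pinfty_ge; exact: num_real.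
  by rewrite /= ltNge x0 /= mulr_ge0 ?tail_ge0 // addr_ge0 // ltW.
have n0 : 0 <= n%:R :> R by [].
pose rho := eta / 2 / (n%:R + 1 + eta / 4).
have den0 : 0 < n%:R + 1 + eta / 4 by lra.
have rho0 : 0 < rho by apply: divr_gt0 => //; lra.
have rhoE : rho * (n%:R + 1 + eta / 4) = eta / 2 by rewrite divfK // gt_eqF.
clearbody rho.
have [e /andP[e0 e1] He] := T_irv.2 _ rho0.
have [D D1 HD] := tail_dominated_variation pP T_irv e0.
have D0 : 0 < D by exact: lt_le_trans ltr01 D1.
pose sml := eta / 4 / ((n%:R + 1) * D).
have den1 : 0 < (n%:R + 1) * D by apply: mulr_gt0 => //; lra.
have sml0 : 0 < sml by apply: divr_gt0 => //; lra.
have smlE : sml * ((n%:R + 1) * D) = eta / 4 by rewrite divfK // gt_eqF.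
clearbody sml.
have eta40 : 0 < eta / 4 by lra.
have e10 : 0 < 1 - e by lra.
near=> x.
have x0 : 0 <= x by near: x; apply: nbhs_pinfty_ge; exact: num_real.
have T0 z : 0 <= T z by exact: tail_ge0.
apply: le_trans (sum_tailS_le n (delta := e) (x := x) _) _; first
  by rewrite mulr_ge0 // ltW.
have h1 : T ((1 - e) * x) <= (1 + rho) * T x by near: x.
have h2 : S n ((1 - e) * x) <= (n%:R + eta / 4) * T ((1 - e) * x).
  near: x; exact: (near_pinftyM (Q := fun x => S n x <=
    (n%:R + eta / 4) * T x) e10 (IHn _ eta40)).
have h3 : S n (e * x) <= (n%:R + 1) * T (e * x).
  near: x; exact: (near_pinftyM (Q := fun x => S n x <=
    (n%:R + 1) * T x) e0 (IHn _ ltr01)).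
have h4 : T (e * x) <= D * T x by near: x.
have h5 : T (e * x) <= sml.
  near: x; exact: (near_pinftyM (Q := fun x => T x <=
    sml) e0 (tail_cvg0 pP sml0)).
have k1 : S n (e * x) * T (e * x) <= eta / 4 * T x.
  apply: (@le_trans _ _ ((n%:R + 1) * (D * T x) * sml)).
    apply: ler_pM => //; first exact: sum_tail_ge0.
    by apply: (le_trans h3); apply: ler_wpM2l => //; lra.
  by rewrite -smlE le_eqVlt; apply/orP; left; apply/eqP; ring.
have k2 : (n%:R + 1 + eta / 4) * T ((1 - e) * x) <=
  (n%:R + 1 + eta / 4) * ((1 + rho) * T x).
  by apply: ler_wpM2l => //; lra.
have k3 : rho * (n%:R + 1 + eta / 4) * T x = eta / 2 * T x by rewrite rhoE.
rewrite -natr1; lra.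
Unshelve. all: by end_near. Qed.

Lemma sum_tail_fixed_ge n (eta : R) : 0 < eta ->
  \forall x \near +oo, (n%:R - eta) * T x <= S n x.
Proof.
elim: n eta => [|n IHn] eta eta0.
  near=> x; apply: le_trans (sum_tail_ge0 pP 0 x).
  by rewrite mulr_le0_ge0 ?tail_ge0 // sub0r oppr_le0 ltW.
have n0 : 0 <= n%:R :> R by [].
have eta20 : 0 < eta / 2 by lra.
pose sml := eta / 2 / (n%:R + 1).
have den1 : 0 < n%:R + 1 :> R by lra.
have sml0 : 0 < sml by apply: divr_gt0.
have smlE : sml * (n%:R + 1) = eta / 2 by rewrite divfK // gt_eqF.
clearbody sml.
near=> x.
have T0 : 0 <= T x by exact: tail_ge0.
apply: le_trans (sum_tailS_ge n x).
have h1 : (n%:R - eta / 2) * T x <= S n x by near: x; exact: IHn.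
have h2 : S n x <= (n%:R + 1) * T x by near: x; exact: sum_tail_fixed_le.
have h3 : T x <= sml by near: x; exact: tail_cvg0.
have h4 : S n x * T x <= eta / 2 * T x.
  apply: ler_wpM2r => //; apply: (le_trans h2).
  by rewrite -smlE mulrC; apply: ler_wpM2r => //; lra.
rewrite -natr1; lra.
Unshelve. all: by end_near. Qed.

(** Exponential Markov inequality for the lower tail. Since [xi >= 0], its
    Laplace transform exists, and truncation at [K] shows that it is at most
    [expR (- theta * b)] for small [theta > 0] as soon as [b < m]. *)
Lemma sum_tail_chernoff (b : R) : b < m -> exists2 theta : R, 0 < theta &
  forall n x, 1 - S n x <= expR (theta * (x - b * n%:R)).
Proof.
move=> bm.
have [K eK] : exists K : nat, E (fun k => k%:R * (K < k)%N%:R) <= (m - b) / 2.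
  near \oo => K; exists K; near: K; apply: mean_excess_cvg0 => //; lra.
set eps := E _ in eK.
have K0 : 0 <= K%:R ^+ 2 :> R by rewrite exprn_ge0.
pose theta := (m - b) / 2 / (K%:R ^+ 2 + 1).
have den0 : 0 < K%:R ^+ 2 + 1 :> R by lra.
have theta0 : 0 < theta by apply: divr_gt0 => //; lra.
have thetaE : theta * (K%:R ^+ 2 + 1) = (m - b) / 2 by rewrite divfK // gt_eqF.
clearbody theta.
have lexp : lin_growth (fun k => expR (- (theta * k%:R))).
  apply: lin_01 => k; rewrite expR_ge0 -expR0 ler_expR oppr_le0.
  by rewrite mulr_ge0 // ltW.
have phi : E (fun k => expR (- (theta * k%:R))) <= expR (- (theta * b)).
  apply: (@le_trans _ _ (1 - theta * b)); last first.
    exact: expR_ge1Dx.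
  apply: (@le_trans _ _ (E (fun k => 1 + theta ^+ 2 * K%:R ^+ 2 +
      ((- theta) * k%:R + theta * (k%:R * (K < k)%N%:R))))).
    apply: mean_le => //; [lin|] => k.
    have k0 : 0 <= k%:R :> R by [].
    have tk0 : 0 <= theta * k%:R by rewrite mulr_ge0 // ltW.
    have tK0 : 0 <= theta ^+ 2 * K%:R ^+ 2
      by rewrite mulr_ge0 // exprn_ge0 // ltW.
    have [kK|Kk] := leqP k K; last first.
      rewrite mulr1; apply: (@le_trans _ _ 1); last by lra.
      by rewrite -[leRHS]expR0 ler_expR oppr_le0.
    rewrite !mulr0 addr0.
    set u := theta * k%:R in tk0 *.
    have u1 : 0 < 1 + u by lra.
    (* [expR (- u) <= (1 + u)^-1 <= 1 - u + u ^+ 2] for [u >= 0]. *)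
    apply: (@le_trans _ _ (1 + u ^+ 2 - u)).
      rewrite expRN; apply: (@le_trans _ _ (1 + u)^-1).
        by rewrite lef_pV2 ?posrE ?expR_gt0 // expR_ge1Dx.
      rewrite -[leLHS]mul1r ler_pdivrMr //.
      have u3 : 0 <= u ^+ 3 by rewrite exprn_ge0.
      have -> : (1 + u ^+ 2 - u) * (1 + u) = 1 + u ^+ 3 by ring.
      by rewrite lerDl.
    rewrite mulNr -/u lerD2r lerD2l /u exprMn ler_wpM2l ?exprn_ge0 ?(ltW
      theta0) //.
    by rewrite lerXn2r ?nnegrE // ler_nat.
  rewrite !meanD //; [|lin..]; rewrite !meanZ //; [|lin..].
  rewrite !(mean_cst pP) -/eps.
  have h1 : theta * eps <= theta * ((m - b) / 2) by apply: ler_wpM2l => //;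
    exact: ltW.
  have h2 : theta * (theta * (K%:R ^+ 2 + 1)) = theta * ((m - b) / 2)
    by rewrite thetaE.
  have h3 : 0 <= theta * theta by rewrite mulr_ge0 // ltW.
  lra.
exists theta => // n; elim: n => [|n IHn] x.
  rewrite /= mulr0 subr0; have [x0|x0] := ltP x 0; first
    by rewrite subrr expR_ge0.
  by rewrite subr0 -expR0 ler_expR mulr_ge0 // ltW.
rewrite [S _ _]/=.
rewrite -[X in X - _](mean_cst pP 1) -mulN1r -(meanZ pP);
  last exact: lin_sum_tail.
rewrite -(meanD pP); [|lin|apply: linZ; exact: lin_sum_tail].
apply: (@le_trans _ _ (E (fun k => expR (theta * (x - b * n%:R)) * expR (-
  (theta * k%:R))))).
  apply: mean_le => //; [lin; exact: lin_sum_tail|lin|] => k.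
  rewrite mulN1r -expRD; apply: le_trans (IHn _) _.
  by rewrite ler_expR le_eqVlt; apply/orP; left; apply/eqP; ring.
rewrite meanZ //; apply: (@le_trans _ _ (expR (theta * (x - b * n%:R)) * expR
  (- (theta * b)))).
  by rewrite ler_wpM2l // expR_ge0.
by rewrite -expRD ler_expR le_eqVlt -natr1; apply/orP; left; apply/eqP; ring.
Unshelve. all: by end_near. Qed.

(** The exponential bound at a level strictly between [b] and [m]. *)
Lemma sum_tail_lln (b eta : R) : b < m -> 0 < eta ->
  \forall n \near \oo, 1 - eta <= S n (b * n%:R).
Proof.
move=> bm eta0; have b'm : (b + m) / 2 < m by lra.
have [theta theta0 Hth] := sum_tail_chernoff b'm.
pose c := theta * ((m - b) / 2).
have c0 : 0 < c by apply: mulr_gt0 => //; lra.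
near=> n.
have nbig : (c * eta)^-1 <= n%:R by near: n; exact: nbhs_infty_ger.
have ce0 : 0 < c * eta by exact: mulr_gt0.
have : 1 - S n (b * n%:R) <= eta; last by lra.
apply: le_trans (Hth _ _) _.
have -> : theta * (b * n%:R - (b + m) / 2 * n%:R) = - (c * n%:R)
  by rewrite /c; field.
have cn : eta^-1 <= c * n%:R.
  by rewrite mulrC -ler_pdivrMr // mulrC -invfM.
rewrite expRN -[leRHS]invrK lef_pV2 ?posrE ?expR_gt0 ?invr_gt0 //.
by apply: (le_trans cn); apply: le_trans (expR_ge1Dx _); rewrite lerDr.
Unshelve. all: by end_near. Qed.

End random_sum.

Section asymptotics.
Context {R : realType}.
Variables (p : nat -> R) (pP : finite_mean_pmf p).
Local Notation E := (mean p).
Local Notation T := (upper_tail p).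
Local Notation S := (sum_tail p).
Local Notation m := (mean p (fun k => k%:R)).
Implicit Types (x y : R).
Hypothesis T_irv : intermediate_regular T.

(** With [n <= (1 - e) * x / m] and [a = m / (1 - e / 2)], the distance
    [x - a * n] is at least a fixed proportion of [x], so the uniform bound
    dominates the terms between [K] and [(1 - e) * x / m] by a multiple of
    [n * T x]; larger [n] are counted with probability [1]. *)
Lemma random_sum_tail_le (eta : R) : 0 < eta ->
  \forall x \near +oo, E (fun n => S n x) <= (1 + eta) * (m * T x + T (x / m)).
Proof.
move=> eta0; have m0 := mean_gt0 pP T_irv.
have T0 z : 0 <= T z by exact: tail_ge0.
have im0 : 0 < m^-1 by rewrite invr_gt0.
have [e /andP[e0 e1] He] := T_irv.2 _ eta0.
have e2 : 0 < 1 - e / 2 by lra.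
pose a := m / (1 - e / 2).
have aE : a * (1 - e / 2) = m by rewrite divfK // gt_eqF.
have ma : m < a by rewrite ltr_pdivlMr //; nra.
have a0 : 0 < a by exact: lt_trans ma.
clearbody a.
have [C C0 HC] := sum_tail_uniform_bound pP T_irv ma.
have [D D1 HD] := tail_dominated_variation pP T_irv (c := e / 2) ltac:(lra).
have D0 : 0 < D by exact: lt_le_trans ltr01 D1.
have CD0 : 0 < C * D by exact: mulr_gt0.
have em0 : 0 < eta * m / 2 by rewrite divr_gt0 // mulr_gt0.
have [K eK] : exists K : nat, C * D * E (fun k => k%:R * (K < k)%N%:R) <=
  eta * m / 2.
  have sml : 0 < eta * m / 2 / (C * D) by rewrite divr_gt0.
  near \oo => K; exists K; rewrite mulrC -ler_pdivlMr //.
  by near: K; exact: mean_excess_cvg0.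
set eps := E _ in eK.
near=> x.
have x0 : 0 <= x by near: x; apply: nbhs_pinfty_ge; exact: num_real.
have small n : (n <= K)%N -> S n x <= (n%:R + eta * m / 2) * T x.
  move: n; near: x; apply: near_forall_leq => n.
  exact: sum_tail_fixed_le.
have hD : T (e / 2 * x) <= D * T x by near: x.
have hE : T ((1 - e) * (x / m)) <= (1 + eta) * T (x / m).
  rewrite (mulrC x); near: x.
  exact: (near_pinftyM (Q := fun x => T ((1 - e) * x) <= (1 + eta) * T x) im0).
have pt n : S n x <= (T x * n%:R + eta * m / 2 * T x)
    + (C * D * T x * (n%:R * (K < n)%N%:R) + ((1 - e) * (x / m) < n%:R)%R%:R).
  have n0 : 0 <= n%:R :> R by [].
  have g1 : 0 <= T x * n%:R by rewrite mulr_ge0.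
  have g2 : 0 <= eta * m / 2 * T x by rewrite mulr_ge0 // ltW.
  have g3 : 0 <= C * D * T x * (n%:R * (K < n)%N%:R).
    by rewrite !mulr_ge0 // ltW.
  have [big|big] := ltP ((1 - e) * (x / m)) n%:R.
    apply: le_trans (sum_tail_le1 pP _ _) _.
    by rewrite addrA -[leLHS]/(true%:R) lerDr !addr_ge0.
  rewrite addr0.
  have [nK|Kn] := leqP n K.
    by rewrite !mulr0 addr0; apply: le_trans (small n nK) _; lra.
  rewrite mulr1.
  have mn : m * n%:R <= (1 - e) * x by rewrite mulrC -ler_pdivlMr // -mulrA.
  have y0 : e / 2 * x <= x - a * n%:R.
    have an : a * n%:R * (1 - e / 2) <= (1 - e) * x.
      by rewrite (mulrAC a) aE.
    have ex : 0 <= e * e * x by rewrite !mulr_ge0 // ltW.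
    rewrite -(ler_pM2r e2); lra.
  have y00 : 0 <= x - a * n%:R.
    by apply: le_trans y0; rewrite mulr_ge0 // divr_ge0 // ltW.
  have := HC n _ y00; rewrite subrK => h.
  have h2 : T (x - a * n%:R) <= D * T x.
    by apply: le_trans hD; apply: tail_le.
  have : C * n%:R * T (x - a * n%:R) <= C * n%:R * (D * T x).
    by rewrite ler_wpM2l // mulr_ge0 // ltW.
  lra.
have lS := lin_sum_tail_index pP x.
apply: le_trans (mean_le pP lS _ pt) _; first by lin.
rewrite !meanD //; [|lin..]; rewrite !meanZ //; [|lin..]; rewrite (mean_cst pP).
rewrite -/(upper_tail p _) -/eps.
have := ler_wpM2r (T0 x) eK.
lra.
Unshelve. all: by end_near. Qed.

(** Only [n <= K], through a single big summand, and [n > (1 + e) * x / m],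
    through the law of large numbers, are kept. *)
Lemma random_sum_tail_ge (eta : R) : 0 < eta -> eta < 1 ->
  \forall x \near +oo, (1 - eta) * (m * T x + T (x / m)) <= E (fun n => S n x).
Proof.
move=> eta0 eta1; have m0 := mean_gt0 pP T_irv.
have T0 z : 0 <= T z by exact: tail_ge0.
have im0 : 0 < m^-1 by rewrite invr_gt0.
have eta20 : 0 < eta / 2 by lra.
have [e /andP[e0 e1] He] := tail_irv_up pP T_irv eta20.
have e10 : 0 < 1 + e by lra.
have em0 : 0 < eta * m / 2 by rewrite divr_gt0 // mulr_gt0.
have [K eK] : exists K : nat, E (fun k => k%:R * (K < k)%N%:R) <= eta * m / 2.
  by near \oo => K; exists K; near: K; exact: mean_excess_cvg0.
set eps := E _ in eK.
have bm : m / (1 + e) < m by rewrite ltr_pdivrMr //; nra.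
have [N _ HN] := sum_tail_lln pP bm eta20.
near=> x.
have x0 : 0 <= x by near: x; apply: nbhs_pinfty_ge; exact: num_real.
have small n : (n <= K)%N -> (n%:R - eta * m / 2) * T x <= S n x.
  move: n; near: x; apply: near_forall_leq => n.
  exact: sum_tail_fixed_ge.
have xbig (M : nat) : (M <= maxn K N)%N -> M%:R <= (1 + e) * (x / m).
  move=> MKN; rewrite mulrA ler_pdivlMr // -ler_pdivrMl //.
  apply: (@le_trans _ _ ((1 + e)^-1 * ((maxn K N)%:R * m))).
    by rewrite ler_wpM2l ?invr_ge0 ?(ltW e10) // ler_wpM2r ?(ltW m0) // ler_nat.
  by near: x; apply: nbhs_pinfty_ge; exact: num_real.
have hE : T (x / m) <= (1 + eta / 2) * T ((1 + e) * (x / m)).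
  rewrite (mulrC x); near: x.
  exact: (near_pinftyM (Q := fun x => T x <=
    (1 + eta / 2) * T ((1 + e) * x)) im0).
have pt n : (T x * n%:R + (- (eta * m / 2 * T x)))
    + ((- T x) * (n%:R * (K < n)%N%:R)
       + (1 - eta / 2) * ((1 + e) * (x / m) < n%:R)%R%:R) <= S n x.
  have g2 : 0 <= eta * m / 2 * T x by rewrite mulr_ge0 // ltW.
  have [big|big] := ltP ((1 + e) * (x / m)) n%:R; last first.
    rewrite mulr0 addr0; have [nK|Kn] := leqP n K.
      by rewrite !mulr0 addr0; apply: le_trans (small n nK); lra.
    by rewrite mulr1; apply: le_trans (sum_tail_ge0 pP n x); lra.
  have Kn : (K < n)%N.
    by rewrite -(ltr_nat R) (le_lt_trans _ big) // xbig // leq_maxl.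
  have Nn : (N <= n)%N.
    by rewrite ltnW // -(ltr_nat R) (le_lt_trans _ big) // xbig // leq_maxr.
  rewrite Kn !mulr1; have /= := HN n Nn.
  have : S n (m / (1 + e) * n%:R) <= S n x.
    apply: sum_tail_le => //; rewrite mulrAC ler_pdivlMr //.
    by move: big; rewrite mulrA ltr_pdivrMr // => /ltW; lra.
  lra.
have lS := lin_sum_tail_index pP x.
apply: le_trans (mean_le pP _ lS pt); last by lin.
rewrite !meanD //; [|lin..]; rewrite !meanZ //; [|lin..]; rewrite (mean_cst pP).
rewrite -/(upper_tail p _) -/eps.
have h1 := ler_wpM2r (T0 x) eK.
have h2 : (1 - eta) * T (x / m) <=
  (1 - eta) * ((1 + eta / 2) * T ((1 + e) * (x / m))).
  by rewrite ler_wpM2l // subr_ge0 ltW.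
have h3 : 0 <= eta * eta * T ((1 + e) * (x / m)) by rewrite !mulr_ge0 // ltW.
lra.
Unshelve. all: by end_near. Qed.

Lemma random_sum_tail_equivalent :
  tail_equivalent (fun x => E (fun n => S n x)) (fun x => m * T x + T (x / m)).
Proof.
have m0 := mean_gt0 pP T_irv.
have g0 x : 0 < m * T x + T (x / m) by rewrite addr_gt0 ?mulr_gt0 ?T_irv.1.
apply/cvgrPdist_le => eps eps0.
pose eta := Num.min eps 2^-1.
have eta0 : 0 < eta by rewrite lt_min eps0 /=; lra.
have eta1 : eta < 1 by rewrite gt_min; apply/orP; right; lra.
have etae : eta <= eps by rewrite ge_min lexx.
near=> x.
have h1 : E (fun n => S n x) <= (1 + eta) * (m * T x + T (x / m)).
  by near: x; exact: random_sum_tail_le.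
have h2 : (1 - eta) * (m * T x + T (x / m)) <= E (fun n => S n x).
  by near: x; exact: random_sum_tail_ge.
apply: le_trans etae; rewrite ler_distlC.
by rewrite ler_pdivlMr // ler_pdivrMr // h1 h2.
Unshelve. all: by end_near. Qed.

End asymptotics.

(** * From random variables to their laws *)

Section laws.
Context d (Omega : measurableType d) (R : realType) (P : probability Omega R).
Implicit Types (N X : {RV P >-> nat}) (B : set Omega).

Definition nat_pmf X (k : nat) : R := fine (P (X @^-1` [set k])).

Lemma measurable_event X (A : set nat) : measurable (X @^-1` A).
Proof. by rewrite -[X in measurable X]setTI; exact: measurable_funP. Qed.

Lemma total_probability N B : measurable B ->
  series (fun k => fine (P (B `&` N @^-1` [set k]))) @ \oo --> fine (P B).
Proof.
move=> mB; pose F k := B `&` N @^-1` [set k].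
have mF k : measurable (F k) by apply: measurableI => //;
  exact: measurable_event.
have BE : \bigcup_k F k = B.
  apply/seteqP; split=> [w [k _ []] //|w Bw]; exists (N w) => //.
have tF : trivIset setT F.
  by move=> i j _ _ [w [[_ /= <-] [_ /= <-]]].
have mUF : measurable (\bigcup_k F k) by rewrite BE.
have := measure_semi_sigma_additive F mF tF mUF (s := P).
rewrite BE => H.
have -> : series (fun k => fine (P (B `&` N @^-1` [set k]))) =
    fine \o (fun n => (\sum_(0 <= i < n) P (F i))%E).
  apply/funext => n /=; rewrite /series /= sum_fine // => i _;
    exact: (fin_num_measure P (F i) (mF i)).
apply: fine_cvg; rewrite fineK //; exact: (fin_num_measure P B mB).
Qed.

Lemma measurable_by_value N (C : nat -> set Omega) :
  (forall k, measurable (C k)) -> measurable [set w | C (N w) w].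
Proof.
move=> mC.
have -> : [set w | C (N w) w] = \bigcup_k (N @^-1` [set k] `&` C k).
  apply/seteqP; split=> [w Cw|w [k _ [/= <-]] //]; exists (N w) => //.
apply: bigcupT_measurable => k; apply: measurableI => //;
  exact: measurable_event.
Qed.

Lemma mean_nat_pmf_indicator X (b : nat -> bool) :
  mean (nat_pmf X) (fun k => (b k)%:R) = fine (P [set w | b (X w)]).
Proof.
have mB : measurable [set w | b (X w)]
  by exact: (measurable_event X (fun k => b k)).
apply: cvg_lim => //; rewrite (_ : (fun k => _) =
    fun k => fine (P ([set w | b (X w)] `&` X @^-1` [set k]))).
  exact: total_probability.
apply/funext => k; rewrite /nat_pmf; case bk : (b k); rewrite ?mulr1 ?mulr0.
  by congr (fine (P _)); apply/seteqP; split=> [w /= Xw|w []//]; rewrite Xw bk.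
rewrite (_ : _ `&` _ = set0) ?measure0 //.
by apply/seteqP; split=> // w [/= bX Xw]; rewrite Xw bk in bX.
Qed.

Lemma nat_pmf_cvg_expectation X : ('E_P[natrRV X] < +oo)%E ->
  series (fun k => nat_pmf X k * k%:R) @ \oo --> fine 'E_P[natrRV X]%E.
Proof.
move=> Xoo.
have E0 : (0 <= 'E_P[natrRV X])%E.
  by rewrite unlock; apply: integral_ge0 => w _; rewrite lee_fin ler0n.
have Efin : 'E_P[natrRV X]%E \is a fin_num by rewrite ge0_fin_numE.
have EE : 'E_P[natrRV X]%E = (\sum_(k <oo) (nat_pmf X k * k%:R)%:E)%E.
  rewrite unlock.
  have UT : [set: Omega] = \bigcup_k (X @^-1` [set k]).
    by apply/seteqP; split=> // w _; exists (X w).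
  rewrite UT ge0_integral_bigcup.
  - apply: eq_eseriesr => k _.
    rewrite (eq_integral (cst (k%:R%:E : \bar R))).
      rewrite integral_cst; last exact: measurable_event.
      rewrite muleC /nat_pmf EFinM fineK //; apply: fin_num_measure;
        exact: measurable_event.
    by move=> w; rewrite inE /= /natrRV => ->.
  - by move=> k; exact: measurable_event.
  - rewrite -UT; apply/measurable_realfun.measurable_EFinP;
    exact: measurable_funP.
  - by move=> w _; rewrite lee_fin ler0n.
  - by move=> i j _ _ [w [/= <- <-]].
have cE : (fun n => (\sum_(0 <= k < n) (nat_pmf X k * k%:R)%:E)%E) @ \oo -->
  'E_P[natrRV X]%E.
  rewrite EE; apply: is_cvg_nneseries => k _ _.
  by rewrite lee_fin mulr_ge0 // fine_ge0.
rewrite -(fineK Efin) in cE.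
have -> : series (fun k => nat_pmf X k * k%:R) =
    fine \o (fun n => (\sum_(0 <= k < n) (nat_pmf X k * k%:R)%:E)%E).
  by apply/funext => n /=; rewrite sumEFin.
exact: fine_cvg.
Qed.

Lemma nat_pmf_finite_mean X : ('E_P[natrRV X] < +oo)%E ->
  finite_mean_pmf (nat_pmf X).
Proof.
move=> Xoo; split.
- by move=> k; rewrite fine_ge0.
- have := total_probability X measurableT; rewrite probability_setT.
  by under eq_fun do rewrite setTI.
- by apply/cvg_ex; exists (fine 'E_P[natrRV X]%E);
  exact: nat_pmf_cvg_expectation.
Qed.

Lemma mean_nat_pmf X : ('E_P[natrRV X] < +oo)%E ->
  mean (nat_pmf X) (fun k => k%:R) = fine 'E_P[natrRV X]%E.
Proof. by move=> Xoo; apply: cvg_lim => //; exact: nat_pmf_cvg_expectation. Qed.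

Section independent_sum.
Variables (xi0 : {RV P >-> nat}) (eta : nat -> {RV P >-> nat}).
Hypothesis xi0_mean : ('E_P[natrRV xi0] < +oo)%E.
Let sum_eta n (w : Omega) : nat := (\sum_(1 <= j < n.+1) eta j w)%N.

Lemma sum_etaS n w : sum_eta n.+1 w = (sum_eta n w + eta n.+1 w)%N.
Proof. by rewrite /sum_eta big_nat_recr. Qed.

Lemma measurable_sum_eta n (y : R) : measurable [set w | y < (sum_eta n w)%:R].
Proof.
elim: n y => [|n IHn] y.
  have [y0|y0] := ltP y 0.
    by rewrite (_ : [set _ | _] = setT) //; apply/seteqP; split=> // w _;
       rewrite /= /sum_eta big_geq.
  rewrite (_ : [set _ | _] = set0) //; apply/seteqP; split=> // w /=.
  by rewrite /sum_eta big_geq // ltNge y0.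
have -> : [set w | y < (sum_eta n.+1 w)%:R] =
    [set w | (fun k => [set w | y - k%:R < (sum_eta n w)%:R]) (eta n.+1 w) w].
  apply/seteqP; split=> w /=; rewrite sum_etaS natrD;
  by rewrite ltrBlDr.
by apply: (measurable_by_value (eta n.+1) (C := fun k => [set w |
  y - k%:R < (sum_eta n w)%:R])) => k; exact: IHn.
Qed.

(** The event [B] carries the conditioning: in the inductive step it absorbs
    [eta n.+1 = k] and the independence hypothesis persists for [n]. This is why
    the hypothesis ranges over arbitrary sets [A j]: the value [setT] for all
    [j] gives the probability of the enlarged event. *)
Lemma independent_sum_tail n B (y : R) : measurable B ->
  (forall A : nat -> set nat,
     fine (P (B `&` [set w | forall j, (1 <= j <= n)%N -> A j (eta j w)])) =
     fine (P B) * \prod_(1 <= j < n.+1) fine (P (xi0 @^-1` A j))) ->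
  fine (P (B `&` [set w | y < (sum_eta n w)%:R])) =
  fine (P B) * sum_tail (nat_pmf xi0) n y.
Proof.
elim: n B y => [|n IHn] B y mB indep.
  rewrite /= /sum_eta; under eq_set do rewrite big_geq //.
  have [y0|y0] := ltP y 0.
    by rewrite mulr1 (_ : [set _ | _] = setT) ?setIT //; apply/seteqP; split.
  rewrite mulr0 (_ : [set _ | _] = set0) ?setI0 ?measure0 //.
  by apply/seteqP; split.
have step k : fine (P ((B `&` [set w |
  y < (sum_eta n.+1 w)%:R]) `&` eta n.+1 @^-1` [set k])) =
    nat_pmf xi0 k * (fine (P B) * sum_tail (nat_pmf xi0) n (y - k%:R)).
  pose B' := B `&` eta n.+1 @^-1` [set k].
  have indep' (A : nat -> set nat) :
      fine (P (B' `&` [set w | forall j, (1 <= j <= n)%N -> A j (eta j w)])) =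
      fine (P B) * (\prod_(1 <= j < n.+1) fine (P (xi0 @^-1` A j)) * nat_pmf
        xi0 k).
    pose A' j := if (j <= n)%N then A j else [set k].
    have -> : B' `&` [set w | forall j, (1 <= j <= n)%N -> A j (eta j w)] =
        B `&` [set w | forall j, (1 <= j <= n.+1)%N -> A' j (eta j w)].
      apply/seteqP; split=> w /=.
        move=> [[Bw Ek] HA]; split=> // j /andP[j1 jn]; rewrite /A'.
        case: leqP => [jn'|nj]; first by apply: HA; rewrite j1.
        by have -> : j = n.+1 by apply/eqP; rewrite eqn_leq jn nj.
      move=> [Bw HA]; split; first split=> //.
        by have := HA n.+1; rewrite leqnn /A' ltnn; exact.
      by move=> j /andP[j1 jn]; have := HA j; rewrite /A' j1 jn leqW //; exact.
    rewrite indep big_nat_recr //= /A' ltnn; congr (_ * (_ * _)).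
    by apply: eq_big_nat => j /andP[_ jn]; rewrite -ltnS jn.
  have PB' : fine (P B') = fine (P B) * nat_pmf xi0 k.
    have := indep' (fun=> setT).
    rewrite (_ : [set w | _] = setT) ?setIT; last by apply/seteqP; split.
    rewrite big1 ?mul1r // => j _.
    by rewrite preimage_setT probability_setT.
  rewrite mulrCA mulrA -PB' -IHn.
  - congr (fine (P _)); apply/seteqP; split=> w /=; rewrite sum_etaS natrD.
      by move=> [[Bw yw] ek]; rewrite ek in yw; split=> //; rewrite ltrBlDr.
    by move=> [[Bw ek] yw]; split=> //; split=> //; rewrite ek -ltrBlDr.
  - by apply: measurableI => //; exact: measurable_event.
  - by move=> A; rewrite indep' PB'; ring.
have mBS : measurable (B `&` [set w | y < (sum_eta n.+1 w)%:R]).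
  by apply: measurableI => //; exact: measurable_sum_eta.
have := total_probability (eta n.+1) mBS.
under eq_fun do rewrite step.
move=> /(cvg_lim (@Rhausdorff R)) <- /=.
exact: (meanZ (nat_pmf_finite_mean xi0_mean) (fine (P B)) (lin_sum_tail
  (nat_pmf_finite_mean xi0_mean) n _)).
Qed.

End independent_sum.
End laws.

(** A limit superior below [1 + eta] is an infimum of suprema, so one of these
    suprema is below [1 + eta]. *)
Lemma intermediate_regular_tail (R : realType) (G : probability R R) :
  intermediate_regularly_varying G -> intermediate_regular (tail G).
Proof.
move=> [G0 Glim]; split=> // eta eta0.
have lt1 : ((1 : \bar R) < (1 + eta)%:E)%E by rewrite lte_fin ltrDl.
pose L (e : R) := limf_esup (fun x : R => (tail G ((1 - e) * x) / tail G x)%:E)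
  (pinfty_nbhs R).
have Hlt : \forall e \near (0 : R)^'+, (L e < (1 + eta)%:E)%E.
  have := Glim _ (open_ereal_lt' lt1); exact.
have [e [e0 e1 He]] : exists e : R, [/\ 0 < e, e < 1 & (L e < (1 + eta)%:E)%E].
  near (0 : R)^'+ => e; exists e; split; last by near: e.
    by near: e; exact: nbhs_right_gt.
  by near: e; exact: nbhs_right_lt.
exists e; first by rewrite e0.
move/ereal_inf_lt : He => [_ [A FA <-] supA].
apply: filterS FA => x Ax.
rewrite -ler_pdivrMr // -lee_fin.
by apply: le_trans (ltW supA); apply: ereal_sup_ubound; exists x.
Unshelve. all: by end_near. Qed.

Theorem corollary2 (R : realType) (d : measure_display)
    (Omega : measurableType d) (P : probability Omega R)
    (xi : nat -> nat -> {RV P >-> nat}) (xi0 : {RV P >-> nat})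
    (xi_indep : mutually_independent
       [set nj : nat * nat | (1 <= nj.1)%N /\ (1 <= nj.2)%N]
       (fun nj => xi nj.1 nj.2))
    (xi_law : forall n j : nat, (1 <= n)%N -> (1 <= j)%N ->
       same_distribution (xi n j) xi0)
    (xi0_mean : ('E_P[natrRV xi0] < +oo)%E)
    (xi0_irv : intermediate_regularly_varying (distribution P (natrRV xi0))) :
  let X := galton_watson xi in
  let m := fine 'E_P[natrRV xi0]%E in
  tail_equivalent
    (fun x : R => fine (P [set w | x < (X 2%N w)%:R]))
    (fun x : R => m * fine (P [set w | x < (xi0 w)%:R])
                  + fine (P [set w | x / m < (xi0 w)%:R])).
Proof.
move=> X m; pose p := nat_pmf xi0.
have pP : finite_mean_pmf p := nat_pmf_finite_mean xi0_mean.
have law n j (A : set nat) : (1 <= n)%N -> (1 <= j)%N ->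
    P (xi n j @^-1` A) = P (xi0 @^-1` A).
  by move=> n1 j1; exact: (xi_law n j n1 j1 A).
have tailE (x : R) : upper_tail p x = fine (P [set w | x < (xi0 w)%:R]).
  exact: (mean_nat_pmf_indicator xi0 (fun k => x < k%:R)).
have T_irv : intermediate_regular (upper_tail p).
  rewrite (_ : upper_tail p = tail (distribution P (natrRV xi0))).
    exact: intermediate_regular_tail.
  apply/funext => x; rewrite tailE /tail /distribution /pushforward.
  by congr (fine (P _)); apply/seteqP; split=> w /=; rewrite in_itv /= andbT.
have X1E w : X 1%N w = xi 1%N 1%N w by rewrite /X /= big_nat1.
have X2E w : X 2%N w = (\sum_(1 <= j < (xi 1%N 1%N w).+1) xi 2%N j w)%N.
  by rewrite -X1E.
have joint k (x : R) : fine (P (xi 1%N 1%N @^-1` [set k] `&`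
    [set w | x < (\sum_(1 <= j < k.+1) xi 2%N j w)%:R])) = p k * sum_tail p k x.
  have -> : p k = fine (P (xi 1%N 1%N @^-1` [set k])) by rewrite law.
  apply: (independent_sum_tail xi0_mean (eta := xi 2%N)).
    exact: measurable_event.
  move=> A.
  (* The family [xi 2] supplies the summands, and the value of [xi 1 1], the
     number of children of the ancestor, is what is conditioned on. *)
  pose J := (1%N, 1%N) :: [seq (2%N, j) | j <- index_iota 1 k.+1].
  pose A' (nj : nat * nat) := if nj.1 == 1%N then [set k] else A nj.2.
  have uJ : uniq J.
    rewrite /J /= map_inj_uniq ?iota_uniq ?andbT; last by move=> i j [].
    by apply/negP => /mapP[].
  have sJ : [set` J] `<=` [set nj | (1 <= nj.1)%N /\ (1 <= nj.2)%N].
    move=> nj /=; rewrite inE => /predU1P[-> //|/mapP[j]].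
    by rewrite mem_index_iota => /andP[j1 _] ->.
  have := xi_indep J A' uJ sJ (fun=> I).
  rewrite big_cons big_map /= {1}/A' /= law // => indepJ.
  transitivity (fine (P (\bigcap_(i in [set` J]) xi i.1 i.2 @^-1` A' i))).
    congr (fine (P _)); apply/seteqP; split=> w /=.
      move=> [Xk HA] nj /=; rewrite inE => /predU1P[-> //|/mapP[j]].
      by rewrite mem_index_iota ltnS => jk ->; exact: HA.
    move=> HJ; split; first by apply: (HJ (1%N, 1%N)); rewrite /= inE eqxx.
    move=> j jk; apply: (HJ (2%N, j)); rewrite /= inE; apply/orP; right.
    by apply: map_f; rewrite mem_index_iota ltnS.
  rewrite indepJ; congr (_ * _).
  by apply: eq_big_nat => j /andP[j1 _]; rewrite law.
pose B (x : R) : set Omega := [set w | x < (X 2%N w)%:R].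
have mB (x : R) : measurable (B x).
  rewrite /B; under eq_set do rewrite X2E.
  apply: (measurable_by_value (xi 1%N 1%N)
    (C := fun k => [set w | x < (\sum_(1 <= j < k.+1) xi 2%N j w)%:R])) => k.
  exact: measurable_sum_eta.
have X2_tail (x : R) : fine (P (B x)) = mean p (fun k => sum_tail p k x).
  apply/esym/cvg_lim => //.
  rewrite (_ : (fun k => _) = fun k => fine (P (B x `&` xi 1%N 1%N @^-1` [set
    k]))).
    exact: total_probability.
  apply/funext => k; rewrite -joint; congr (fine (P _)).
  apply/seteqP; split=> w [].
    by move=> /= Xk xS; split; rewrite // /B /= X2E Xk.
  by rewrite /B /= X2E => xS Xk; split=> //; rewrite -Xk.
have mE : mean p (fun k => k%:R) = m by exact: mean_nat_pmf.
have := random_sum_tail_equivalent pP T_irv.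
rewrite /tail_equivalent mE.
under eq_fun do rewrite -X2_tail !tailE.
by [].
Qed.
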